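(* For each integer $k\ge 5$ let $T_k^{(3)}$ be the language of all finite words over a $k$-letter alphabet that contain no minimal $(k/(k-1))^+$-power $u$ with $|u|-\operatorname{per}(u)\le 3$ as a factor, and let $\alpha(T_k^{(3)})$ be its growth rate. Let $D$ be the two-dimensional ternary language over $\{\mathtt V,\mathtt L,\mathtt R\}$ defined in the context, and let $\alpha(D)$ be its two-dimensional growth rate. Then the limit $\lim_{k\to\infty}\alpha(T_k^{(3)})$ exists and is equal to $\alpha(D)$.
   Context: **Powers and the languages $T_k^{(3)}$.** For a nonempty finite word $w$, $\operatorname{per}(w)$ is its minimal period and $\exp(w)=|w|/\operatorname{per}(w)$ is its exponent. Let $k\ge5$ and let $\Sigma_k$ be a $k$-letter alphabet. Let $A_k$ be the set of all words $u$ over $\Sigma_k$ with $\exp(u)>k/(k-1)$ such that every proper factor of $u$ has exponent at most $k/(k-1)$ (the ''minimal $(k/(k-1))^+$-powers''). Each $u\in A_k$ factorizes as $u=yzy$ with $|yz|=\operatorname{per}(u)$, so $|y|=|u|-\operatorname{per}(u)$; $u$ is called an $m$-repetition if $|y|=m$. Let $A_k^{(3)}$ be the set of all $u\in A_k$ with $|u|-\operatorname{per}(u)\le 3$. Then $T_k^{(3)}$ is the set of all finite words over $\Sigma_k$ having no factor in $A_k^{(3)}$. **Growth rate of a (one-dimensional) language.** For a language $L$ let $C_L(n)$ be the number of words of length $n$ in $L$, and $\alpha(L)=\limsup_{n\to\infty}(C_L(n))^{1/n}$ (for factorial, i.e. factor-closed, languages this is a limit, by Fekete's lemma). **The two-dimensional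 language $D$.** A 2-dimensional word of size $n\times k$ is an array of letters with $n$ rows and $k$ columns; its factors are its contiguous rectangular subarrays. $D$ is the set of all rectangular words over the three-letter alphabet $\Delta=\{\mathtt V,\mathtt L,\mathtt R\}$ such that: 1. (rows) every row is a factor of a two-sided infinite concatenation of the blocks $\mathtt{VLR}$ and $\mathtt{LR}$; equivalently, no row contains any of $\mathtt{VV},\mathtt{LL},\mathtt{RR},\mathtt{VR},\mathtt{LV}$ as a factor; 2. (vertical) there is no $2\times1$ factor $\begin{smallmatrix}\mathtt V\\ \mathtt V\end{smallmatrix}$; 3. (square) there is no $2\times 2$ factor $\begin{smallmatrix}\mathtt R&\mathtt L\\ \mathtt R&\mathtt L\end{smallmatrix}$. Let $C_D(n,k)$ be the number of words of size $n\times k$ in $D$. The growth rate of $D$ is $\alpha(D)=\lim_{n,k\to\infty}(C_D(n,k))^{1/(nk)}$ (a double limit, which exists by the multivariate Fekete lemma because $C_D$ is submultiplicative in each variable). *)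

(* Defs.v *)
From HB Require Import structures.
From mathcomp Require Import all_boot all_order all_algebra.
From mathcomp Require Import all_classical all_reals all_analysis.
Set Implicit Arguments.
Unset Strict Implicit.
Unset Printing Implicit Defensive.
Import Order.TTheory GRing.Theory Num.Theory.
Import numFieldNormedType.Exports.
Local Open Scope classical_set_scope.
Local Open Scope ring_scope.

Section Words.
Variable T : eqType.
Implicit Types u v w : seq T.

Definition is_period w (p : nat) : bool :=
  (0 < p)%N && all (fun i => onth w i == onth w (i + p)%N) (iota 0 (size w - p)).

Lemma ex_period w : exists p, is_period w p.
Proof.
by exists (size w).+1; rewrite /is_period (eqP (leqnSn (size w))).
Qed.

(* For nonempty w the minimum is at most size w; the empty word gets
   period 1, hence exponent 0. *)
Definition per w : nat := ex_minn (ex_period w).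

Definition exponent w : rat := (size w)%:R / (per w)%:R.

(* Every factor v != u is a proper one; u is nonempty as soon as 0 <= b. *)
Definition minimal_power (b : rat) u : Prop :=
  b < exponent u /\
  forall v, infix v u -> v != u -> exponent v <= b.

End Words.

Definition A (k : nat) : set (seq 'I_k) :=
  [set u | minimal_power (k%:R / (k%:R - 1)) u].

Definition A3 (k : nat) : set (seq 'I_k) :=
  [set u | A u /\ (size u - per u <= 3)%N].

Definition T3 (k : nat) : set (seq 'I_k) :=
  [set w | forall u, infix u w -> ~ A3 u].
Arguments T3 k : clear implicits.

Definition num_words (T : finType) (L : set (seq T)) (n : nat) : nat :=
  #|[pred w : n.-tuple T | tval w \in L]|.

(* The term n = 0, where n^-1 = 0, does not affect the limsup. *)
Definition growth_rate (R : realType) (T : finType) (L : set (seq T)) : R :=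
  limn_sup (fun n : nat => (num_words L n)%:R `^ n%:R^-1 : R).

Variant letter := letV | letL | letR.

Definition ord_of_letter (a : letter) : 'I_3 :=
  match a with letV => inord 0 | letL => inord 1 | letR => inord 2 end.

Definition letter_of_ord (i : 'I_3) : letter := nth letV [:: letV; letL; letR] i.

Lemma ord_of_letterK : cancel ord_of_letter letter_of_ord.
Proof. by case; rewrite /letter_of_ord /= inordK. Qed.

HB.instance Definition _ := Finite.copy letter (can_type ord_of_letterK).

(* x is a two-sided infinite concatenation of the blocks VLR and LR: the i-th
   block is b i, and it starts at position c i.  Every block has positive
   length, so the blocks cover all of the integers. *)
Definition block_concatenation (x : int -> letter) : Prop :=
  exists (b : int -> seq letter) (c : int -> int), forall i : int,
    [/\ b i = [:: letV; letL; letR] \/ b i = [:: letL; letR],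
        c (i + 1) = c i + (size (b i))%:Z
      & forall j : nat, (j < size (b i))%N -> x (c i + j%:Z) = nth letV (b i) j].

Definition row_condition (m : nat) (r : 'I_m -> letter) : Prop :=
  exists x : int -> letter, block_concatenation x /\
    exists p : int, forall j : 'I_m, r j = x (p + (val j)%:Z).

Definition language2 (T : Type) : Type :=
  forall n m : nat, set 'M[T]_(n, m).

Definition D : language2 letter := fun n m => [set w |
  [/\ forall i : 'I_n, row_condition (w i),
      forall (i i' : 'I_n) (j : 'I_m), val i' = (val i).+1 ->
        ~ (w i j = letV /\ w i' j = letV)
    & forall (i i' : 'I_n) (j j' : 'I_m),
        val i' = (val i).+1 -> val j' = (val j).+1 ->
        ~ [/\ w i j = letR, w i j' = letL, w i' j = letR & w i' j' = letL]]].

Definition num_words2 (T : finType) (L : language2 T) (n m : nat) : nat :=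
  #|[pred w : 'M[T]_(n, m) | w \in L n m]|.

Definition root_num_words2 (R : realType) (T : finType) (L : language2 T)
    (nm : nat * nat) : R :=
  (num_words2 L nm.1 nm.2)%:R `^ (nm.1 * nm.2)%:R^-1.

(* A joint limit: both dimensions tend to infinity independently.  It is
   meaningful when root_num_words2 R L converges. *)
Definition growth_rate2 (R : realType) (T : finType) (L : language2 T) : R :=
  lim (root_num_words2 R L nm @[nm --> (\oo, \oo)]).

(* Main.v *)
Require Import Defs.
From mathcomp Require Import all_boot all_order all_algebra.
From mathcomp Require Import all_classical all_reals all_analysis.
From mathcomp Require Import zify ring lra.
Set Implicit Arguments.
Unset Strict Implicit.
Unset Printing Implicit Defensive.
Import Order.TTheory GRing.Theory Num.Theory.
Import numFieldNormedType.Exports.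
Local Open Scope classical_set_scope.
Local Open Scope ring_scope.

(**
If a word avoids the repetitions in question, then any k - 1 consecutive letters
are distinct, and every letter beyond a short prefix equals the one k - 1, k or
k + 1 positions earlier; these cases are coded by L, V and R.  The repetitions
with |y| = 2 give the row condition on the sequence of codes, and those with
|y| = 3 say that, once the code is wound around a cylinder of circumference k
(position t lies above position t + k), the vertical and the square patterns are
absent.  Thus T_k^(3) counts helical D-words of width k up to a bounded factor.

Cutting a helical word into rows gives a D-word, whence the upper bound.
Conversely any D-word of width k - 9 can be wound around the cylinder: the 9
missing columns are filled so that each row becomes LRLR... in a phase prescribed
by the parity of the row.  With s the infimum of ln C_D(n, m) / (n m), this gives
s (1 - 10 / k) <= ln alpha(T_k^(3)) <= s + o(1), and a two-dimensional Fekete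
argument shows that ln alpha(D) = s.
*)

(** * Minimal powers and repetitions *)

Section Repetitions.
Local Open Scope nat_scope.

Lemma is_periodP (T : eqType) (x0 : T) (w : seq T) (p : nat) :
  reflect (0 < p /\ forall i, i + p < size w -> nth x0 w i = nth x0 w (i + p))
          (is_period w p).
Proof.
rewrite /is_period; apply: (iffP andP) => -[p0 H]; split => //.
  move=> i ip; move/allP: H => /(_ i); rewrite mem_iota add0n leq0n /=.
  have -> : (i < size w - p) by lia.
  by move=> /(_ isT)/eqP; rewrite -!(odflt_onth x0) => ->.
apply/allP => i; rewrite mem_iota add0n leq0n /= => ip.
have ip1 : i + p < size w by lia.
have ip2 : i < size w by lia.
by rewrite !onthE !(nth_map x0) // H.
Qed.

Lemma per_period (T : eqType) (w : seq T) : is_period w (per w).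
Proof. by rewrite /per; case: ex_minnP. Qed.

Lemma per_gt0 (T : eqType) (w : seq T) : 0 < per w.
Proof. by case/andP: (per_period w). Qed.

Lemma per_le (T : eqType) (w : seq T) (p : nat) : is_period w p -> per w <= p.
Proof. by rewrite /per; case: ex_minnP => m _ H /H. Qed.

Lemma exponent_gt (T : eqType) (k : nat) (u : seq T) : 1 < k ->
  (k%:R / (k%:R - 1) < exponent u)%R = (k * per u < k.-1 * size u).
Proof.
move=> k1; rewrite /exponent.
have -> : (k%:R - 1 = k.-1%:R :> rat)%R by rewrite -subn1 natrB //; lia.
rewrite ltr_pdivrMr ?ltr0n; last lia.
rewrite mulrAC ltr_pdivlMr ?ltr0n ?per_gt0 // -!natrM ltr_nat.
by rewrite [size u * _]mulnC.
Qed.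

(** For a factor of length p + m with period p, the ratio (p + m) / p exceeds k / (k - 1) exactly
    when p < (k - 1) m. Minimality of the power disappears here; [T3P] recovers it. *)
Definition repetition_free (T : Type) (k : nat) (w : nat -> T) (n : nat) :=
  forall m p i, 0 < m <= 3 -> 0 < p < k.-1 * m -> i + p + m <= n ->
  ~ forall j, j < m -> w (i + j) = w (i + j + p).

(** A shortest factor of exponent above the bound is a minimal power. A repetition with m <= 3 makes
    its length less than 3k, and this forces |y| <= 3. *)
Lemma T3P (k : nat) (x0 : 'I_k) (w : seq 'I_k) : 1 < k ->
  T3 k w <-> repetition_free k (nth x0 w) (size w).
Proof.
move=> k1; split => [Tw m p i m3 pk ipm H|H u].
  pose P n := `[< exists v, [/\ infix v w, size v = n
                & (k%:R / (k%:R - 1) < exponent v)%R] >].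
  pose v0 := take (p + m) (drop i w).
  have sv0 : size v0 = p + m by rewrite size_takel // size_drop; lia.
  have Pv0 : P (p + m).
    apply/asboolP; exists v0; split => //.
      by apply: infix_trans (infix_drop w i); exact: infix_take.
    rewrite exponent_gt // sv0.
    have : per v0 <= p.
      apply/per_le/(is_periodP x0 _ _); split; first by lia.
      move=> j; rewrite sv0 => jm; rewrite !nth_take ?nth_drop; try lia.
      by rewrite addnA; apply: H; lia.
    by nia.
  case: (ex_minnP (ex_intro P _ Pv0)) => n /asboolP[v [vw sv ev]] nmin.
  have npm := nmin _ Pv0.
  apply: (Tw v vw); split; first split => //.
    move=> u uv neq; rewrite leNgt; apply/negP => eu.
    have : n <= size u.
      by apply: nmin; apply/asboolP; exists u; split => //; exact: infix_trans uv vw.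
    move=> nu; case/infixP: uv neq => s [s' vE].
    move: nu; rewrite -sv vE !size_cat => sle; apply/negP; rewrite negbK.
    have /size0nil -> : size s = 0 by lia.
    have /size0nil -> : size s' = 0 by lia.
    by rewrite cats0.
  rewrite leqNgt sv; apply/negP => big.
  (* If |v| - per v >= 4, then [u], whose exponent is at most k / (k - 1), gives per v >= 3 (k - 1).
     Hence |v| > 3k, against |v| <= p + m < 3k. *)
  pose u := take n.-1 v.
  have su : size u = n.-1 by rewrite size_takel // sv; lia.
  have : ~~ (k%:R / (k%:R - 1) < exponent u)%R.
    apply/negP => eu.
    have : n <= n.-1.
      apply: nmin; apply/asboolP; exists u; split => //.
      by apply: infix_trans vw; exact: infix_take.
    by lia.
  rewrite exponent_gt // su.
  have : per u <= per v.
    apply/per_le/(is_periodP x0 _ _); split; first exact: per_gt0.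
    move=> j; rewrite su => jm; rewrite !nth_take; try lia.
    by case/(is_periodP x0 _ _): (per_period v) => _; apply; lia.
  move=> uv; rewrite -leqNgt => le_u.
  have : k.-1 * n.-1 <= k * per v by apply: leq_trans le_u _; rewrite leq_mul2l uv orbT.
  have : k.-1 * (per v + 3) <= k.-1 * n.-1 by rewrite leq_mul2l; lia.
  have : k.-1 * m <= k.-1 * 3 by rewrite leq_mul2l; lia.
  have -> : k * per v = k.-1 * per v + per v by rewrite -{1}(ltn_predK k1) mulSn addnC.
  by rewrite mulnDr; lia.
move=> /infixP[s [s' wE]] [[eu _] m3].
move: eu; rewrite exponent_gt // => eu.
have [p0 Hp] := is_periodP x0 _ _ (per_period u).
have ? : per u < size u.
  by rewrite ltnNge; apply/negP => ?; move: eu; rewrite ltnNge leq_mul //; lia.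
apply: (H (size u - per u) (per u) (size s)).
- by rewrite subn_gt0; apply/andP; split.
- by rewrite p0 mulnBr ltn_subRL addnC -mulSn (ltn_predK k1).
- by rewrite wE !size_cat -addnA subnKC ?addnA ?leq_addr // ltnW.
- move=> j jm; rewrite wE !nth_cat.
  have -> : (size s + j < size s) = false by lia.
  have -> : (size s + j + per u < size s) = false by lia.
  have -> : size s + j - size s = j by lia.
  have -> : size s + j + per u - size s = j + per u by lia.
  have -> : j < size u by lia.
  have -> : j + per u < size u by lia.
  by apply: Hp; lia.
Qed.

End Repetitions.

(** * From words to codes *)

Section Codes.
Local Open Scope nat_scope.

Lemma repetition_freeP (T : Type) (k : nat) (w : nat -> T) (n : nat) :
  repetition_free k w n <->
  [/\ forall i p, 0 < p < k.-1 -> i + p < n -> w i <> w (i + p),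
      forall i p, 0 < p < k.-1 * 2 -> i.+1 + p < n -> w i = w (i + p) ->
        w i.+1 <> w (i.+1 + p)
    & forall i p, 0 < p < k.-1 * 3 -> i.+2 + p < n -> w i = w (i + p) ->
        w i.+1 = w (i.+1 + p) -> w i.+2 <> w (i.+2 + p)].
Proof.
split=> [H|[H1 H2 H3] [|[|[|[|m]]]] p i //=].
  split=> i p p0 ipn.
  - move=> e; apply: (H 1 p i) => //; try lia.
    by case=> [|j] // _; rewrite addn0.
  - move=> e1 e2; apply: (H 2 p i) => //; try lia.
    by case=> [|[|j]] // _; rewrite ?addn0 ?addn1.
  - move=> e1 e2 e3; apply: (H 3 p i) => //; try lia.
    by case=> [|[|[|j]]] // _; rewrite ?addn0 ?addn1 ?addn2.
- move=> _ p0 ipn H; apply: (H1 i p); try lia.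
  by have := H 0 isT; rewrite addn0.
- move=> _ p0 ipn H; apply: (H2 i p); try lia.
  + by have := H 0 isT; rewrite addn0.
  + by have := H 1 isT; rewrite addn1.
- move=> _ p0 ipn H; apply: (H3 i p); try lia.
  + by have := H 0 isT; rewrite addn0.
  + by have := H 1 isT; rewrite addn1.
  + by have := H 2 isT; rewrite addn2.
Qed.

(** The local form of the row condition: all pairs but VV, LL, RR, VR and LV. *)
Definition adj (a b : letter) : bool :=
  match a, b with
  | letV, letL | letL, letR | letR, letL | letR, letV => true
  | _, _ => false
  end.

(* The two-dimensional constraints on the plane in which position t has the
   right neighbour t + 1 and the lower neighbour t + k. *)
Definition helical (k : nat) (d : nat -> letter) (n : nat) : Prop :=
  [/\ forall t, t.+1 < n -> adj (d t) (d t.+1),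
      forall t, t + k < n -> d t = letV -> d (t + k) <> letV
    & forall t, t.+1 + k < n -> d t = letR -> d t.+1 = letL ->
        d (t + k) = letR -> d (t.+1 + k) <> letL].

(* When w is repetition free, the previous occurrence of the letter w (t + k)
   is at distance k - 1, k or k + 1. *)
Definition source (a : letter) (t : nat) : nat :=
  match a with letL => t.+1 | letV => t | letR => t.-1 end.

(** R is only the default case; [codeR] shows that in a repetition free word it means distance k +
    1, from t = 2 on. *)
Definition code (T : eqType) (k : nat) (w : nat -> T) (t : nat) : letter :=
  if w (t + k) == w t.+1 then letL
  else if w (t + k) == w t then letV else letR.

Section CodesOfWords.
Variables (k : nat) (w : nat -> 'I_k) (n : nat).
Hypotheses (k_ge5 : 5 <= k) (w_free : repetition_free k w n).

Let w_free1 i j : i < j < i + k.-1 -> j < n -> w i <> w j.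
Proof.
case/repetition_freeP: w_free => + _ _ => /(_ i (j - i)) H ij jn.
have <- : i + (j - i) = j by lia.
by apply: H; lia.
Qed.

Let w_free2 i p : 0 < p < k.-1 * 2 -> i.+1 + p < n -> w i = w (i + p) ->
  w i.+1 <> w (i.+1 + p).
Proof. by case/repetition_freeP: w_free => _ + _; apply. Qed.

Let w_free3 i p : 0 < p < k.-1 * 3 -> i.+2 + p < n -> w i = w (i + p) ->
  w i.+1 = w (i.+1 + p) -> w i.+2 <> w (i.+2 + p).
Proof. by case/repetition_freeP: w_free => _ _ ; apply. Qed.

Let codeL t : code k w t = letL -> w (t + k) = w t.+1.
Proof. by rewrite /code; case: eqP => // _; case: eqP. Qed.

Let codeV t : code k w t = letV -> w (t + k) = w t.
Proof. by rewrite /code; case: eqP => // _; case: eqP. Qed.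

Let codeNL t : code k w t <> letL -> w (t + k) <> w t.+1.
Proof. by rewrite /code; case: eqP. Qed.

Lemma window_onto (f : nat -> 'I_k) s x :
  (forall i j, s <= i -> i < j -> j < s + k -> f i <> f j) ->
  exists2 i, s <= i < s + k & x = f i.
Proof.
move=> H.
have U : uniq (map f (iota s k)).
  rewrite map_inj_in_uniq ?iota_uniq // => i j; rewrite !mem_iota => hi hj e.
  by case: (ltngtP i j) => // ij; [case: (H i j)|case: (H j i)] => //; lia.
have sz : size (enum 'I_k) <= size (map f (iota s k)).
  by rewrite size_map size_iota size_enum_ord.
have [_ E] := uniq_min_size U (fun y _ => mem_enum 'I_k y) sz.
have : x \in map f (iota s k) by rewrite E mem_enum.
by case/mapP => i; rewrite mem_iota => hi ->; exists i.
Qed.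

(** Any k - 1 consecutive letters are distinct, and a code other than L also separates the two ends
    of this window, so its k letters exhaust the alphabet. *)
Let window t x : code k w t <> letL -> t + k < n ->
  exists2 i, t < i <= t + k & x = w i.
Proof.
move=> cN tn; have [] := @window_onto w t.+1 x.
  move=> i j ti ij jt e; have [jlt|jge] := ltnP j (i + k.-1).
    by apply: (w_free1 (i := i) (j := j)) => //; lia.
  have [ie je] : i = t.+1 /\ j = t + k by lia.
  by apply: (codeNL cN); rewrite -ie -je.
by move=> i hi xE; exists i => //; lia.
Qed.

Let code_not_LL t : t.+1 + k < n -> code k w t = letL -> code k w t.+1 <> letL.
Proof.
move=> tn /codeL e1 /codeL e2; apply: (w_free2 (i := t.+1) (p := k.-1)); try lia.
  by rewrite -e1; congr w; lia.
by rewrite -e2; congr w; lia.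
Qed.

(** The letter at t + k differs from those at t, ..., t + k - 1, so these do not exhaust the
    alphabet and the code at t - 1 is L. Then the code at t - 2 is not L, the window from t - 1 to t
    + k - 2 contains every letter, and only position t - 1 is left. *)
Let codeR t : 1 < t -> t + k < n -> code k w t = letR ->
  code k w t.-1 = letL /\ w (t + k) = w t.-1.
Proof.
case: t => [|[|t]] //= _ tn cR.
have wN i : t.+1 < i < t.+2 + k -> w (t.+2 + k) <> w i.
  move=> hi; have [/eqP ->|h] := boolP (i == t.+2).
    by move: cR; rewrite /code; case: eqP => //; case: eqP.
  have [/eqP ->|h'] := boolP (i == t.+3).
    by apply: codeNL; rewrite cR.
  by apply: nesym; apply: w_free1; lia.
have c1 : code k w t.+1 = letL.
  apply/eqP/negP => /negP/eqP c1.
  have [i hi] := window (w (t.+2 + k)) c1 (ltnW tn).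
  by apply: wN; lia.
split=> //.
have c0 : code k w t <> letL.
  by move=> c0; apply: (code_not_LL _ c0) => //; lia.
have tn' : t + k < n by lia.
have [i hi wi] := window (w (t.+2 + k)) c0 tn'.
have [e|iN] := eqVneq i t.+1; first by rewrite wi e.
have [e|iN'] := eqVneq i (t + k); last by case: (wN i) => //; lia.
by case: (wN i) => //; lia.
Qed.

Lemma source_code t : 1 < t -> t + k < n -> w (t + k) = w (source (code k w t) t).
Proof.
move=> t1 tn; case E: (code k w t) => /=.
- exact: codeV.
- exact: codeL.
- by case: (codeR t1 tn E).
Qed.

(** VV is a repetition with |y| = 2 and period k, LV puts two equal letters side by side, and R
    comes only after L. *)
Let code_adj t : 0 < t -> t.+1 + k < n -> adj (code k w t) (code k w t.+1).
Proof.
move=> t0 tn; case E1: (code k w t.+1).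
- case E: (code k w t) => //=.
  + by case: (@w_free2 t k) => //; rewrite ?codeV //; lia.
  + have := codeL E; have := codeV E1; rewrite addSn => e1 e2.
    by case: (@w_free1 (t + k) (t + k).+1); rewrite ?e1 //; lia.
- by case E: (code k w t) => //=; case: (code_not_LL _ E).
- by case: (codeR _ tn E1) => //= -> _.
Qed.

(** The shift by 3 stays clear of the start, where [codeR] does not apply. Excluding V above V at s
    = t + 3 reads letters up to position s + 2k + 2, whence the length n - k - 5. *)
Lemma helical_code : helical k (fun t => code k w (t + 3)) (n - k - 5).
Proof.
split=> [t tn|t tn|t tn].
- by apply: code_adj; lia.
- move=> cV1; rewrite addnAC => cV2; set s := t + 3 in cV1 cV2.
  have sn : s.+2 + k + k < n by lia.
  have next u : 0 < u -> u.+2 + k < n -> code k w u = letV ->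
      code k w u.+1 = letL /\ code k w u.+2 = letR.
    move=> u0 un cu; have := code_adj u0 (ltnW un); rewrite cu.
    case E1 : (code k w u.+1) => // _; split => //.
    by have := @code_adj u.+1 isT un; rewrite E1; case: (code k w u.+2).
  have [||cL1 cR1] := next _ _ _ cV1; try lia.
  have [||cL2 cR2] := next _ _ _ cV2; try lia.
  (* V keeps a letter and LR swaps two neighbours, so VLR above VLR restores three letters after 2k
     positions: a repetition with |y| = 3. *)
  apply: (@w_free3 s (k + k)); rewrite ?addnA; try lia.
  + by rewrite (codeV cV2) codeV.
  + by rewrite (codeL cL2) (@source_code s.+2) ?cR1 //; lia.
  + have := @source_code (s + k).+2; rewrite cR2 !addSn => -> //; try lia.
    by rewrite -addSn (codeL cL1).
- rewrite addSn (addnAC t) (addnAC t.+1) !addSn; set s := t + 3 => cR1 cL1 cR2 cL2.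
  have sn : s.+2 + k + k < n by lia.
  have next u : u.+2 + k < n -> code k w u.+1 = letL -> code k w u.+2 = letR.
    by move=> un cu; have := @code_adj u.+1 isT un; rewrite cu; case: (code _ _ _).
  have cR1' := next s _ cL1; have cR2' := next (s + k) _ cL2.
  have [||cL0 e1] := codeR _ _ cR1; try lia.
  have [||cL0' e2] := codeR _ _ cR2; try lia.
  have e3 := codeL cL0; have e4 := codeL cL0'.
  have e5 := codeL cL2; have e6 : w (s.+2 + k) = w s.+1.
    by rewrite source_code ?cR1' //; lia.
  rewrite /s addn3 in e1 e2 e3 e4 e5 e6 sn *.
  rewrite /= !addSn /= in e1 e2 e3 e4 e5 e6 sn.
  (* The square extends to LRLR above LRLR, and swapping twice restores the letters from s - 1 =
     [t.+2] on. *)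
  apply: (@w_free3 t.+2 (k + k)); rewrite ?addSn ?addnA; try lia.
  + by rewrite e4.
  + by rewrite e2.
  + by rewrite e5.
Qed.

End CodesOfWords.
End Codes.

(** * From codes to words *)

Section WordsOfCodes.
Local Open Scope nat_scope.
Variables (T : Type) (k : nat) (d : nat -> letter) (N : nat) (w : nat -> T).
Hypotheses (k_ge5 : 5 <= k) (d_helical : helical k d N) (d0 : d 0 <> letR).
Hypothesis w_inj : forall i j, i < j < k -> w i <> w j.
Hypothesis w_rec : forall t, t < N -> w (t + k) = w (source (d t) t).

Let d_adj t : t.+1 < N -> adj (d t) (d t.+1).
Proof. by case: d_helical => + _ _; apply. Qed.

(* A block VLR or LR rearranges the last k letters, so that these are pairwise
   distinct at the end of each block. *)
Let window_inj t : t <= N -> t = 0 \/ d t.-1 <> letL ->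
  forall i j, t <= i -> i < j -> j < t + k -> w i <> w j.
Proof.
elim/ltn_ind: t => -[|u] IH uN bu i j ti ij jt; first by apply: w_inj; lia.
have {bu} dN : d u <> letL by case: bu.
case E: (d u) dN => // _.
- have bu : u = 0 \/ d u.-1 <> letL.
    case: (u) uN E => [|v] vN E; [by left|right; have := d_adj vN].
    by rewrite E /=; case: (d v).
  have H := IH u (ltnSn u) (ltnW uN) bu.
  have [jlt|jge] := ltnP j (u + k); first by apply: H; lia.
  have -> : j = u + k by lia.
  by rewrite w_rec // E /=; apply: nesym; apply: H; lia.
- case: u uN E ti jt IH => [|u] uN E ti jt IH; first by case: d0.
  have du : d u = letL by have := d_adj uN; rewrite E; case: (d u).
  have bu : u = 0 \/ d u.-1 <> letL.
    case: (u) uN du => [|v] vN E'; [by left|right; have := @d_adj v].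
    by rewrite E' /=; case: (d v) => // /(_ (ltnW vN)).
  have H := IH u (ltnW (ltnSn _)) (ltnW (ltnW uN)) bu.
  have e1 : w (u + k) = w u.+1 by rewrite w_rec ?du //; lia.
  have e2 : w (u.+1 + k) = w u by rewrite w_rec ?E.
  have [jlt|jge] := ltnP j (u + k); first by apply: H; lia.
  have [je|jne] := eqVneq j (u + k).
    by rewrite je e1; apply: nesym; apply: H; lia.
  have -> : j = u.+1 + k by lia.
  rewrite e2; have [ie|ine] := eqVneq i (u + k).
    by rewrite ie e1; apply: nesym; apply: H; lia.
  by apply: nesym; apply: H; lia.
Qed.

Let w_free1 i j : i < j < i + k.-1 -> j < N + k -> w i <> w j.
Proof.
move=> ij jN; set t := minn i N.
have tN : t <= N by lia.
have [bt|] := pselect (t = 0 \/ d t.-1 <> letL).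
  by apply: (window_inj tN bt); lia.
move=> /not_orP[t0 /contrapT dt].
(* Position t follows an L, between the two letters of a block LR. The window one step earlier is
   injective, and the letter at u + k repeats the one at u + 1. *)
have [u tE] : exists u, t = u.+1 by exists t.-1; lia.
rewrite tE /= in dt tN.
have bu : u = 0 \/ d u.-1 <> letL.
  case: (u) dt tN => [|v] E vN; [by left|right; have := @d_adj v].
  by rewrite E /=; case: (d v) => // /(_ vN).
have H := window_inj (ltnW tN) bu.
have [jlt|jge] := ltnP j (u + k); first by apply: H; lia.
have -> : j = u + k by lia.
by rewrite w_rec ?dt //=; apply: nesym; apply: H; lia.
Qed.

Let dist (a : letter) : nat :=
  match a with letL => k.-1 | letV => k | letR => k.+1 end.

Let source_dist t : source (d t) t + dist (d t) = t + k.
Proof.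
case: t => [|t]; last by case: (d t.+1) => /=; lia.
by case: (d 0) d0 => //=; lia.
Qed.

(** Equal letters are at least k - 1 apart. So the source of the later one cannot lie before i,
    where it would be at most 2 away from i; it is i itself or lies at least k - 1 beyond. *)
Let w_rep1 i p : 0 < p -> i + p < N + k -> w i = w (i + p) ->
  exists t, [/\ i + p = t + k, t < N &
    p = dist (d t) \/
    [/\ k.-1 + dist (d t) <= p, i + (p - dist (d t)) = source (d t) t
      & w i = w (i + (p - dist (d t)))]].
Proof.
move=> p0 ipN e.
have kp : k.-1 <= p.
  by rewrite leqNgt; apply/negP => pk; apply: (@w_free1 i (i + p)) => //; lia.
have kip : k <= i + p.
  by rewrite leqNgt; apply/negP => ipk; apply: (@w_inj i (i + p)) => //; lia.
have [t tE] : exists t, i + p = t + k by exists (i + p - k); lia.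
exists t; split => //; first by lia.
have tN : t < N by lia.
have sd := source_dist t; have es := w_rec tN.
have dl : dist (d t) <= k.+1 by case: (d t) => /=; lia.
set D := dist (d t) in sd dl *.
have [pD|pD|] := ltngtP p D; [exfalso|right|by left].
  have si : source (d t) t < i by lia.
  apply: (w_free1 (i := source (d t) t) (j := i)); rewrite -?es -?tE //.
    by lia.
  by lia.
have ES : i + (p - D) = source (d t) t by lia.
have ei : w i = w (i + (p - D)) by rewrite ES -es -tE.
split => //; rewrite leqNgt; apply/negP => pk.
by apply: (w_free1 (i := i) (j := i + (p - D))) => //; lia.
Qed.

(** Since p < 3 (k - 1), the way back from i + p to i consists of at most two steps, each of length
    at least k - 1. *)
Let w_rep2 i p : 0 < p < k.-1 * 3 -> i + p < N + k -> w i = w (i + p) ->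
  exists t, [/\ i + p = t + k, t < N &
    p = dist (d t) \/
    exists u, source (d t) t = u + k /\ p = dist (d t) + dist (d u)].
Proof.
move=> /andP[p0 pk] ipN /(w_rep1 p0 ipN)[t [tE tN H]].
exists t; split => //; case: H => [|[kp ES e]]; [by left|right].
have [||u [uE uN H]] := w_rep1 _ _ e; first by lia.
  by have := source_dist t; lia.
exists u; split; first by rewrite -ES.
case: H => [|[kp' _ _]]; first by lia.
have : k.-1 <= dist (d t) by case: (d t) => /=; lia.
have : k.-1 <= dist (d u) by case: (d u) => /=; lia.
by lia.
Qed.

(** Consecutive positions of a repetition share p. If they return in one step each, two neighbouring
    codes agree, against adjacency; if three return in two steps each, a forbidden vertical or
    square pattern appears. *)
Lemma helical_repetition_free : repetition_free k w (N + k).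
Proof.
apply/repetition_freeP; split.
- by move=> i p pk ipN; apply: w_free1; lia.
- move=> i p pk ipN e1 e2.
  have [||t [tE tN [pE|[u [_ pE]]]]] := w_rep2 _ _ e1; try lia; last first.
    by case: (d t) (d u) pE => [] [] /=; lia.
  have [||t' [tE' tN' [pE'|[u [_ pE']]]]] := w_rep2 _ _ e2; try lia; last first.
    by case: (d t') (d u) pE' => [] [] /=; lia.
  have t'E : t' = t.+1 by lia.
  rewrite t'E in pE' tN'; move: (d_adj tN') pE pE'.
  by case: (d t) (d t.+1) => [] [] //=; lia.
- move=> i p pk ipN e1 e2 e3.
  have [||t [tE tN H1]] := w_rep2 _ _ e1; try lia.
  have [||t2 [tE2 tN2 H2]] := w_rep2 _ _ e2; try lia.
  have [||t3 [tE3 tN3 H3]] := w_rep2 _ _ e3; try lia.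
  have t2E : t2 = t.+1 by lia.
  have t3E : t3 = t.+2 by lia.
  subst t2 t3; clear tE2 tE3 e1 e2 e3.
  have dist_ge a : k.-1 <= dist a by case: a => /=; lia.
  have dist_le a : dist a <= k.+1 by case: a => /=; lia.
  have a1 := d_adj tN2; have a2 := d_adj tN3.
  case: H1 => [p1|[u1 [s1 p1]]].
    case: H2 => [p2|[u2 [_ p2]]]; last first.
      by move: (dist_le (d t)) (dist_ge (d t.+1)) (dist_ge (d u2)); lia.
    by move: a1 p1 p2; case: (d t) (d t.+1) => [] [] //=; lia.
  case: H2 => [p2|[u2 [s2 p2]]].
    by move: (dist_le (d t.+1)) (dist_ge (d t)) (dist_ge (d u1)); lia.
  case: H3 => [p3|[u3 [s3 p3]]].
    by move: (dist_le (d t.+2)) (dist_ge (d t)) (dist_ge (d u1)); lia.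
  have [s tk] : exists s, t = s + k.
    exists (t - k); move: s1 s2 a1.
    by case: (d t) (d t.+1) => [] [] //=; lia.
  subst t; have [_ dVV dRL] := d_helical.
  have noVV u : u + k < N -> d (u + k) = letV -> d u <> letV.
    by move=> uN + du; exact: dVV.
  have noRL u : u.+1 + k < N -> d (u + k) = letR -> d (u.+1 + k) = letL ->
      d u = letR -> d u.+1 <> letL.
    by move=> uN e e' du du'; apply: (dRL u).
  (* Adjacency leaves VLR, LRV, LRL, RVL and RLR in the lower row. Equating the three sums of two
     distances determines enough of the codes above to give V above V or, with adjacency, RL above
     RL. *)
  case E1: (d (s + k)) s1 p1 a1 => s1 p1; case E2: (d (s + k).+1) s2 p2 a2 => s2 p2 //;
    case E3: (d (s + k).+2) s3 p3 => s3 p3 // _ _; rewrite /= in s1 s2 s3 p1 p2 p3.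
  + have [u1E u2E u3E] : [/\ u1 = s, u2 = s.+2 & u3 = s.+1] by split; lia.
    subst u1 u2 u3; move: (noVV s tN E1) p1 p2 p3.
    by case: (d s) (d s.+1) (d s.+2) => [] [] [] /=; lia || tauto.
  + have [u1E u2E u3E] : [/\ u1 = s.+1, u2 = s & u3 = s.+2] by split; lia.
    subst u1 u2 u3; move: (noVV s.+2 tN3 E3) p1 p2 p3.
    by case: (d s) (d s.+1) (d s.+2) => [] [] [] /=; lia || tauto.
  + have [u1E u2E u3E] : [/\ u1 = s.+1, u2 = s & u3 = s.+3] by split; lia.
    have a1 : adj (d s.+1) (d s.+2) by apply: d_adj; lia.
    have a2 : adj (d s.+2) (d s.+3) by apply: d_adj; lia.
    subst u1 u2 u3; move: (noRL s.+1 tN3 E2 E3) p1 p2 p3 a1 a2.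
    by case: (d s) (d s.+1) (d s.+2) (d s.+3) => [] [] [] [] //=; lia || tauto.
  + have [r sE] : exists r, s = r.+1 by exists s.-1; lia.
    have [u1E u2E u3E] : [/\ u1 = r, u2 = s.+1 & u3 = s.+3] by split; lia.
    subst u1 u2 u3; move: (noVV s.+1 tN2 E2) p1 p2 p3.
    by case: (d r) (d s.+1) (d s.+3) => [] [] [] /=; lia || tauto.
  + have [r sE] : exists r, s = r.+1 by exists s.-1; lia.
    have [u1E u2E u3E] : [/\ u1 = r, u2 = s.+2 & u3 = s.+1] by split; lia.
    have a1 : adj (d r) (d s) by rewrite sE; apply: d_adj; lia.
    have a2 : adj (d s) (d s.+1) by apply: d_adj; lia.
    subst u1 u2 u3; move: (noRL s tN2 E1 E2) p1 p2 p3 a1 a2.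
    by case: (d r) (d s) (d s.+1) (d s.+2) => [] [] [] [] //=; lia || tauto.
Qed.

(** Letters at distance 1 or 2 differ, so the letter at t + k matches only one of those at t - 1, t
    and t + 1. *)
Lemma code_of_decoding (T' : eqType) (v : nat -> T') (t : nat) :
  repetition_free k v (N + k) -> (forall t, t < N -> v (t + k) = v (source (d t) t)) ->
  t < N -> code k v t = d t.
Proof.
case/repetition_freeP => v_free _ _ v_rec tN; rewrite /code v_rec //.
have v_free1 i p : 0 < p < k.-1 -> i + p < N + k -> (v i == v (i + p)) = false.
  by move=> pk iN; apply/eqP; exact: v_free.
case E: (d t) => /=.
- by rewrite -addn1 v_free1 ?eqxx //; lia.
- by rewrite eqxx.
- case: t tN E => [|t] tN E; first by case: d0.
  have := @v_free1 t 1; rewrite addn1 => ->; try lia.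
  by have := @v_free1 t 2; rewrite addn2 => -> //; lia.
Qed.

End WordsOfCodes.

(** * Tracing a letter back to the first k positions *)

Section Decoding.
Local Open Scope nat_scope.
Variables (k : nat) (d : nat -> letter).

(** [f] is fuel. For k > 1 each step lowers the position, so starting with [f] = [t] suffices and
    the final 0 is not reached. The origins themselves serve as the letters of the decoded word. *)
Fixpoint origin_rec (f t : nat) : nat :=
  if t < k then t
  else if f is f'.+1 then origin_rec f' (source (d (t - k)) (t - k)) else 0.

Definition origin (t : nat) : nat := origin_rec t t.

Lemma source_lt a t : 1 < k -> source a t < t + k.
Proof. by case: a => /=; lia. Qed.

Lemma origin_small t : t < k -> origin t = t.
Proof. by case: t => [|t] /=; rewrite /origin /= => ->. Qed.

Lemma originD t : 1 < k -> origin (t + k) = origin (source (d t) t).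
Proof.
move=> k1; have fuel : forall f u, u <= f -> origin_rec f u = origin_rec u u.
  elim/ltn_ind=> f IH u uf; case: f u uf IH => [|f] [|u] //= uf IH.
    by case: ifP => // ; lia.
  case: ifP => // uk; have := @source_lt (d (u.+1 - k)) (u.+1 - k) k1.
  by rewrite subnK 1?leqNgt ?uk // ltnS => su; rewrite !IH //; lia.
have := @source_lt (d t) t k1; rewrite /origin; case E : (t + k) => [|s] // st.
rewrite /= -E addnK ltnNge leq_addl /=; apply: fuel; lia.
Qed.

Lemma origin_lt t : 1 < k -> origin t < k.
Proof.
move=> k1; elim/ltn_ind: t => t IH; have [tk|kt] := ltnP t k.
  by rewrite origin_small.
rewrite -(subnK kt) originD //; apply: IH.
by rewrite -[X in _ < X](subnK kt) source_lt.
Qed.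

End Decoding.

(** * Rows of D *)

Section Rows.

Lemma block_concatenation_adj (x : int -> letter) (z : int) :
  block_concatenation x -> adj (x z) (x (z + 1)).
Proof.
case=> b [c bc].
have [i [j jb ->]] : exists i, exists2 j, (j < size (b i))%N & z = c i + j%:Z.
  (* Blocks are nonempty, so induction on the offset from [c 0] in both directions places every
     integer in a block. *)
  suff H t : exists i, exists2 j, (j < size (b i))%N & c 0 + t = c i + j%:Z.
    by have [i [j jb]] := H (z - c 0); rewrite addrC subrK => zE; exists i, j.
  elim: t => [|n [i [j jb E]]|n [i [j jb E]]].
  - exists 0, 0%N => //; by case: (bc 0) => -[] -> _ _.
  - have [jb'|jb'] := ltnP j.+1 (size (b i)).
      by exists i, j.+1 => //; lia.
    exists (i + 1), 0%N; first by case: (bc (i + 1)) => -[] -> _ _.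
    by case: (bc i) => _ -> _; lia.
  - case: j jb E => [|j] jb E.
      exists (i - 1), (size (b (i - 1))).-1.
        by case: (bc (i - 1)) => -[] -> _ _.
      case: (bc (i - 1)) => H; rewrite subrK => cE _; move: E; rewrite cE.
      by case: H => -> /=; lia.
    by exists i, j; [exact: ltnW | lia].
have [bi cE xE] := bc i; rewrite xE //.
have [jb'|jb'] := ltnP j.+1 (size (b i)).
  have -> : c i + j%:Z + 1 = c i + j.+1%:Z by lia.
  by rewrite xE //; case: bi jb jb' => ->; case: j => [|[|[|j]]].
have -> : c i + j%:Z + 1 = c (i + 1) + 0%:Z by lia.
have [bi' _ xE'] := bc (i + 1); rewrite xE'; last by case: bi' => ->.
by case: bi bi' jb jb' => -> [] ->; case: j => [|[|[|j]]].
Qed.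

Definition next_letter (a : letter) : letter :=
  match a with letV | letR => letL | letL => letR end.

Fixpoint extend_row (s : seq letter) (n : nat) : letter :=
  if (n < size s)%N then nth letV s n
  else if n is n'.+1 then next_letter (extend_row s n') else letL.

Lemma extend_row_nth s n : (n < size s)%N -> extend_row s n = nth letV s n.
Proof. by case: n => /= [|n] ->. Qed.

Lemma extend_row_adj s n :
  (forall j, (j.+1 < size s)%N -> adj (nth letV s j) (nth letV s j.+1)) ->
  adj (extend_row s n) (extend_row s n.+1).
Proof.
move=> sadj /=; case: ifP => ns; last by case: (extend_row s n).
by rewrite extend_row_nth ?sadj // ltnW.
Qed.

Fixpoint block_start (x : nat -> letter) (n : nat) : nat :=
  if n is n'.+1 then
    (block_start x n' + if x (block_start x n') is letV then 3 else 2)%N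
  else 0%N.

Lemma block_start_neqR (x : nat -> letter) (n : nat) :
  x 0%N <> letR -> (forall j, adj (x j) (x j.+1)) -> x (block_start x n) <> letR.
Proof.
move=> x0 xadj; elim: n => [|n IH] //=; set t := block_start x n in IH *.
rewrite ?addn3 ?addn2; have := (xadj t, xadj t.+1, xadj t.+2).
case: (x t) IH => //= _ []; rewrite ?addn3 ?addn2.
all: case: (x t.+1) => //=; case: (x t.+2) => //=; case: (x t.+3) => //=.
all: by case.
Qed.

(* The word is continued to the left by the blocks LR. *)
Lemma block_concatenation_nat (x : nat -> letter) :
  x 0%N <> letR -> (forall j, adj (x j) (x j.+1)) ->
  exists2 y : int -> letter, block_concatenation y & forall j : nat, y j%:Z = x j.
Proof.
move=> x0 xadj.
exists (fun z => match z with Posz j => x j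
  | Negz n => if odd n then letL else letR end) => //.
exists (fun z => match z with
    | Posz n => if x (block_start x n) is letV then [:: letV; letL; letR]
                else [:: letL; letR]
    | Negz n => [:: letL; letR] end).
exists (fun z => match z with Posz n => (block_start x n)%:Z
  | Negz n => - (n.+1 * 2)%:Z end).
case=> n.
  have := @block_start_neqR x n x0 xadj.
  have -> : (Posz n + 1 = Posz n.+1)%R by lia.
  rewrite /=; set t := block_start x n; have := (xadj t, xadj t.+1).
  case E: (x t) => //= -[a1 a2] _; (split; [by tauto|lia|]).
    case=> [|[|[|j]]] // _; rewrite -?PoszD ?addn0 ?addn1 ?addn2 //=.
      by case: (x t.+1) a1.
    by case: (x t.+1) (x t.+2) a1 a2 => [] [].
  case=> [|[|j]] // _; rewrite -?PoszD ?addn0 ?addn1 //=.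
  by case: (x t.+1) a1.
split; first by right.
  case: n => [|n]; first by rewrite /=; lia.
  by have -> : Negz n.+1 + 1 = Negz n; rewrite /=; lia.
move=> [|[|j]] // _.
  have -> : - (n.+1 * 2)%:Z + 0%:Z = Negz (n * 2).+1 by lia.
  by rewrite /= oddM andbF.
have -> : - (n.+1 * 2)%:Z + 1%:Z = Negz (n * 2) by lia.
by rewrite /= oddM andbF.
Qed.

Lemma row_conditionP (m : nat) (r : 'I_m -> letter) :
  row_condition r <->
  forall j j' : 'I_m, val j' = (val j).+1 -> adj (r j) (r j').
Proof.
split=> [[x [bx [p rE]]] j j' jj'|radj].
  rewrite !rE jj'; have -> : p + (val j).+1%:Z = p + (val j)%:Z + 1 by lia.
  exact: block_concatenation_adj.
pose s := [seq r i | i <- enum 'I_m].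
have sE (j : 'I_m) : nth letV s j = r j.
  by rewrite (nth_map j) ?size_enum_ord // nth_ord_enum.
have ss : size s = m by rewrite size_map size_enum_ord.
have sadj j : (j.+1 < size s)%N -> adj (nth letV s j) (nth letV s j.+1).
  rewrite ss => jm; rewrite (sE (Ordinal (ltnW jm))) (sE (Ordinal jm)).
  exact: radj.
(* A row starting with R starts inside a block; an L in front makes a block start at position 0. *)
pose s' := if extend_row s 0%N is letR then letL :: s else s.
have [x0 s'adj] : extend_row s' 0%N <> letR /\
    forall j, (j.+1 < size s')%N -> adj (nth letV s' j) (nth letV s' j.+1).
  rewrite /s'; case E: (extend_row s 0) => //; rewrite ?E; split => //.
  case=> [|j] /=; last by exact: sadj.
  by move=> /= s0; move: E; rewrite extend_row_nth // => ->.
have [y yb yE] := block_concatenation_nat x0 (fun j => @extend_row_adj s' j s'adj).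
exists y; split => //.
exists (if extend_row s 0%N is letR then 1%:Z else 0) => j.
rewrite -sE; move: yE; rewrite /s'; case: (extend_row s 0) => yE.
- by rewrite add0r yE extend_row_nth ?ss ?ltn_ord.
- by rewrite add0r yE extend_row_nth ?ss ?ltn_ord.
- by rewrite -PoszD add1n yE extend_row_nth /= ?ss ?ltnS ?ltn_ord.
Qed.

Lemma in_D (n m : nat) (w : 'M[letter]_(n, m)) : w \in (D : language2 letter) n m <->
  [/\ forall i (j j' : 'I_m), val j' = (val j).+1 -> adj (w i j) (w i j'),
      forall (i i' : 'I_n) j, val i' = (val i).+1 -> w i j = letV ->
        w i' j <> letV
    & forall (i i' : 'I_n) (j j' : 'I_m), val i' = (val i).+1 ->
        val j' = (val j).+1 -> w i j = letR -> w i j' = letL ->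
        w i' j = letR -> w i' j' <> letL].
Proof.
rewrite inE; split=> -[H1 H2 H3]; split.
- by move=> i; apply/row_conditionP.
- by move=> i i' j ii e1 e2; apply: (H2 _ _ j ii).
- by move=> i i' j j' ii jj e1 e2 e3 e4; apply: (H3 _ _ _ _ ii jj).
- by move=> i; apply/row_conditionP; apply: H1.
- by move=> i i' j ii [e1 e2]; apply: (H2 _ _ j ii).
- by move=> i i' j j' ii jj [e1 e2 e3 e4]; apply: (H3 _ _ _ _ ii jj).
Qed.

End Rows.

(** * Gluing D-words into helical words *)

Section Gluing.
Local Open Scope nat_scope.

(* The row with end letter a is continued to the right, and at a letter R the
   choice between L and V depends on the parity of the row plus the column.
   So two adjacent rows never make the same choice in the same column, which
   excludes the forbidden patterns; after at most four columns the rows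
   are alternately LRLR... and RLRL... in the phase prescribed by b. *)
Fixpoint right_extension (b : bool) (a : letter) (s : nat) : letter :=
  if s is s'.+1 then
    match right_extension b a s' with
    | letV => letL
    | letL => letR
    | letR => if b (+) odd s' then letV else letL
    end
  else a.

Fixpoint left_extension (b : bool) (a : letter) (s : nat) : letter :=
  if s is s'.+1 then
    match left_extension b a s' with
    | letV => letR
    | letR => letL
    | letL => if b (+) odd s' then letV else letR
    end
  else a.

(* At s = 5 both extensions are in the alternating regime, in the same phase. *)
Definition strip (b : bool) (a a' : letter) (s : nat) : letter :=
  if s <= 5 then right_extension b a s else left_extension (~~ b) a' (10 - s).

Lemma strip_adj b a a' s :
  s < 10 -> adj (strip b a a' s) (strip b a a' s.+1).
Proof.
move=> s10; do 10! [case: s s10 => [_|s s10]; first by case: b a a' => [] [] []].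
by [].
Qed.

(** The ends s = 0 and s = 10 are left out: there stand letters of the given array. *)
Lemma strip_VV b a1 a1' a2 a2' s : 0 < s < 10 ->
  strip b a1 a1' s = letV -> strip (~~ b) a2 a2' s <> letV.
Proof.
case: s => // s s10.
do 9! [case: s s10 => [_|s s10];
  first by rewrite /strip /=; case: b a1 a2 a1' a2' => [] [] [] // [] []].
by [].
Qed.

(** Here s = 0 and s = 9 treat the squares with one column in the strip and one in the given
    array. *)
Lemma strip_RL b a1 a1' a2 a2' s : s < 10 ->
  strip b a1 a1' s = letR -> strip b a1 a1' s.+1 = letL ->
  strip (~~ b) a2 a2' s = letR -> strip (~~ b) a2 a2' s.+1 <> letL.
Proof.
move=> s10; do 10! [case: s s10 => [_|s s10];
  first by rewrite /strip /=; case: b a1 a2 a1' a2' => [] [] [] // [] []].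
by [].
Qed.

Variables (q m : nat) (x : nat -> nat -> letter).
Hypotheses (m_gt0 : 0 < m)
  (x_adj : forall i j, i < q -> j.+1 < m -> adj (x i j) (x i j.+1))
  (x_VV : forall i j, i.+1 < q -> j < m -> x i j = letV -> x i.+1 j <> letV)
  (x_RL : forall i j, i.+1 < q -> j.+1 < m -> x i j = letR -> x i j.+1 = letL ->
     x i.+1 j = letR -> x i.+1 j.+1 <> letL).

(** Row i of the strip leads from the last letter of row i - 1 to the first letter of row i. For i =
    0 the choice of V makes the glued word start with L, so that its first code is not R. *)
Let S i := strip (odd i) (if i is i'.+1 then x i' m.-1 else letV) (x i 0).

Definition glued (t : nat) : letter :=
  let i := t %/ (m + 9) in let j := t %% (m + 9) in
  if j < 9 then S i j.+1 else x i (j - 9).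

Lemma glued_entry i j : j < m -> glued (i * (m + 9) + (9 + j)) = x i j.
Proof.
move=> jm; rewrite /glued divnMDl ?addn_gt0 ?orbT // modnMDl.
rewrite divn_small ?modn_small; try lia.
by rewrite addn0 ltnNge leq_addr /= addKn.
Qed.

Let glued_strip i j : j <= 9 -> glued (i * (m + 9) + j) = S i j.+1.
Proof.
rewrite leq_eqVlt => /predU1P[->|j9]; first by rewrite -[9]addn0 glued_entry.
rewrite /glued divnMDl ?addn_gt0 ?orbT // modnMDl.
by rewrite divn_small ?modn_small; try lia; rewrite addn0 j9.
Qed.

Let glued_end i : glued (i * (m + 9) + (m + 9).-1) = S i.+1 0.
Proof.
transitivity (x i m.-1) => //.
by rewrite -glued_entry; [congr glued; lia|lia].
Qed.

(** A pair of neighbours is governed by the strip, including its two ends and the passage to the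
    next turn of the helix (s = 0), or else lies inside the given array. *)
Let glued_pairP t :
  (exists i s, [/\ s < 10, glued t = S i s /\ glued t.+1 = S i s.+1 &
     glued (t + (m + 9)) = S i.+1 s /\ glued (t.+1 + (m + 9)) = S i.+1 s.+1]) \/
  (exists i j, [/\ j.+1 < m, t = i * (m + 9) + (9 + j),
     glued t = x i j /\ glued t.+1 = x i j.+1 &
     glued (t + (m + 9)) = x i.+1 j /\ glued (t.+1 + (m + 9)) = x i.+1 j.+1]).
Proof.
set k := m + 9; have tE := divn_eq t k; have jk : t %% k < k by rewrite ltn_mod; lia.
move: (t %/ k) (t %% k) jk tE => i j jk ->.
have -> : i * k + j + k = i.+1 * k + j by rewrite mulSn; lia.
have -> : (i * k + j).+1 + k = i.+1 * k + j.+1 by rewrite mulSn; lia.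
rewrite -addnS; have [j9|j9] := ltnP j 9.
  by left; exists i, j.+1; rewrite !glued_strip //; lia.
have [jk'|jk'] := ltnP j.+1 k.
  right; have [c jE] : exists c, j = 9 + c by exists (j - 9); lia.
  rewrite {}jE /k in jk' *; exists i, c.
  have cm : c.+1 < m by lia.
  by rewrite -!addnS !glued_entry // ltnW.
left; exists i.+1, 0.
have -> : j = k.-1 by lia.
have e n : n * k + k.-1.+1 = n.+1 * k + 0 by rewrite mulSn; lia.
by rewrite !e !glued_end !glued_strip.
Qed.

Lemma helical_glued : helical (m + 9) glued (q * (m + 9)).
Proof.
have lt_row i c b : i * (m + 9) + c < b * (m + 9) -> i < b.
  by move=> h; rewrite -(@ltn_pmul2r (m + 9)) ?addn_gt0 ?orbT //; lia.
split=> t tq.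
- have [[i [s [s10 [-> ->] _]]]|[i [j [jm tE [-> ->] _]]]] := glued_pairP t.
    exact: strip_adj.
  by apply: x_adj => //; apply: (lt_row _ (9 + j)); rewrite -tE ltnW.
- move: tq; have jk : t %% (m + 9) < m + 9 by rewrite ltn_mod; lia.
  rewrite {1 2 3}(divn_eq t (m + 9)); move: (t %/ _) (t %% _) jk => i j jk.
  rewrite addnAC -mulSnr => iq; have [j9|j9] := ltnP j 9.
    by rewrite !glued_strip 1?ltnW //; apply: strip_VV; lia.
  have -> : j = 9 + (j - 9) by lia.
  by rewrite !glued_entry; try lia; apply: x_VV; [exact: lt_row iq|lia].
- have [[i [s [s10 [-> ->] [-> ->]]]]|[i [j [jm tE [-> ->] [-> ->]]]]] := glued_pairP t.
    exact: strip_RL.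
  apply: x_RL => //; apply: (lt_row _ (9 + j)).
  by rewrite mulSnr addnAC -tE ltnW.
Qed.

Lemma glued0 : glued 0 <> letR.
Proof. by rewrite -[0]/(0 * (m + 9) + 0) glued_strip. Qed.

End Gluing.

(** * Counting *)

Section Counting.
Local Open Scope nat_scope.

Lemma leq_card_inj (T T' : finType) (P : {pred T}) (Q : {pred T'}) (f : T -> T') :
  {in P &, injective f} -> (forall x, x \in P -> f x \in Q) -> #|P| <= #|Q|.
Proof.
move=> f_inj fPQ; rewrite -(card_in_image f_inj); apply/subset_leq_card/fintype.subsetP.
by move=> _ /fintype.imageP[x xP ->]; exact: fPQ.
Qed.

Lemma num_words2_rows (n1 n2 m : nat) :
  num_words2 D (n1 + n2) m <= num_words2 D n1 m * num_words2 D n2 m.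
Proof.
rewrite /num_words2 -cardX.
apply: (@leq_card_inj _ _ _ _ (fun w => (usubmx w, dsubmx w))).
  by move=> w w' _ _ [e1 e2]; rewrite -(vsubmxK w) e1 e2 vsubmxK.
move=> w wD; have /in_D[H1 H2 H3] : w \in @D _ _ := wD.
apply/andP; split; apply/in_D; split.
- by move=> i j j' jj; rewrite /= !mxE; apply: H1.
- by move=> i i' j ii; rewrite /= !mxE; apply: H2.
- by move=> i i' j j' ii jj; rewrite /= !mxE; apply: H3.
- by move=> i j j' jj; rewrite /= !mxE; apply: H1.
- by move=> i i' j ii; rewrite /= !mxE; apply: H2; rewrite /= ii addnS.
- by move=> i i' j j' ii jj; rewrite /= !mxE; apply: H3; rewrite //= ii addnS.
Qed.

Lemma num_words2_columns (n m1 m2 : nat) :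
  num_words2 D n (m1 + m2) <= num_words2 D n m1 * num_words2 D n m2.
Proof.
rewrite /num_words2 -cardX.
apply: (@leq_card_inj _ _ _ _ (fun w => (lsubmx w, rsubmx w))).
  by move=> w w' _ _ [e1 e2]; rewrite -(hsubmxK w) e1 e2 hsubmxK.
move=> w wD; have /in_D[H1 H2 H3] : w \in @D _ _ := wD.
apply/andP; split; apply/in_D; split.
- by move=> i j j' jj; rewrite /= !mxE; apply: H1.
- by move=> i i' j ii; rewrite /= !mxE; apply: H2.
- by move=> i i' j j' ii jj; rewrite /= !mxE; apply: H3.
- by move=> i j j' jj; rewrite /= !mxE; apply: H1; rewrite /= jj addnS.
- by move=> i i' j ii; rewrite /= !mxE; apply: H2.
- by move=> i i' j j' ii jj; rewrite /= !mxE; apply: H3; rewrite //= jj addnS.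
Qed.

Lemma num_words2_gt0 (n m : nat) : 0 < num_words2 D n m.
Proof.
apply/card_gt0P; exists (\matrix_(i, j) if odd (i + j) then letR else letL).
apply/in_D; split.
- by move=> i j j' jj; rewrite !mxE jj addnS /=; case: odd.
- by move=> i i' j _; rewrite !mxE; case: odd.
- by move=> i i' j j' ii jj; rewrite !mxE ii jj !addSn /=; case: odd.
Qed.

(** The array is glued and decoded from the distinct initial letters 0, ..., k - 1. The code of the
    resulting word gives the array back, so the map is injective. *)
Lemma num_words_T3_ge (q m : nat) :
  num_words2 D q.+1 m.+1 <=
  num_words (T3 (m.+1 + 9)) (q.+1 * (m.+1 + 9) + (m.+1 + 9)).
Proof.
set k := m.+1 + 9; have k1 : 1 < k by rewrite /k; lia.
have k5 : 5 <= k by rewrite /k; lia.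
pose x0 : 'I_k := Ordinal (ltnW k1).
pose x (X : 'M[letter]_(q.+1, m.+1)) i j := X (inord i) (inord j).
pose d X := glued m.+1 (x X).
pose f X : (q.+1 * k + k).-tuple 'I_k :=
  [tuple insubd x0 (origin k (d X) i) | i < q.+1 * k + k].
have fE X i : i < q.+1 * k + k -> nth x0 (f X) i = insubd x0 (origin k (d X) i).
  by move=> iN; rewrite -[i]/(val (Ordinal iN)) -tnth_nth tnth_mktuple.
have f_rec X t : t < q.+1 * k ->
    nth x0 (f X) (t + k) = nth x0 (f X) (source (d X t) t).
  move=> tq; have := @source_lt k (d X t) t k1 => st.
  by rewrite !fE ?originD //; lia.
have f_inj X i j : i < j < k -> nth x0 (f X) i <> nth x0 (f X) j.
  move=> ij; rewrite !fE; try lia; move=> /(congr1 val).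
  by rewrite !val_insubd !origin_lt // !origin_small; lia.
have d_helical X : X \in @D q.+1 m.+1 -> helical k (d X) (q.+1 * k).
  move=> /in_D[H1 H2 H3]; apply: helical_glued => // i j iq jm; rewrite /x.
  - by apply: H1; rewrite /= !inordK // ltnW.
  - by apply: H2; rewrite /= !inordK // ltnW.
  - by apply: H3; rewrite /= !inordK // ltnW.
have f_free X : X \in @D q.+1 m.+1 -> repetition_free k (nth x0 (f X)) (q.+1 * k + k).
  move=> XD; apply: (helical_repetition_free k5 (d_helical X XD) (glued0 _)) => //.
  - exact: f_inj.
  - exact: f_rec.
apply: (@leq_card_inj _ _ _ _ f) => [X X' XD X'D e|X XD].
  apply/matrixP => i j.
  have xE Y : Y \in @D q.+1 m.+1 ->
      Y i j = code k (nth x0 (f Y)) (i * k + (9 + j)).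
    move=> YD.
    rewrite (code_of_decoding k5 (d := d Y) _ (f_free Y YD) (f_rec Y)).
    - by rewrite /d glued_entry // /x !inord_val.
    - exact: glued0.
    - apply: (@leq_trans (i.+1 * k)); last by rewrite leq_mul2r ltn_ord orbT.
      by rewrite mulSnr ltn_add2l /k addnC ltn_add2r.
  by rewrite !xE // e.
have : tval (f X) \in T3 k; last by [].
by rewrite inE; apply/(T3P x0 _ k1); rewrite size_tuple; exact: f_free.
Qed.

Lemma num_words_T3_le (k q n : nat) : 5 <= k -> q * k + k + 5 <= n ->
  num_words (T3 k) n <= k ^ (n - q * k) * num_words2 D q k.
Proof.
move=> k5 qn.
have k0 : 0 < k by lia.
pose x0 := Ordinal k0.
pose s := n - q * k.
(* The s recorded letters are the first k + 3 and those from position q k + k + 3 on; the q k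
   letters between are recovered from the codes by [source_code]. *)
pose f (w : n.-tuple 'I_k) : {ffun 'I_s -> 'I_k} * 'M[letter]_(q, k) :=
  ([ffun i : 'I_s => nth x0 w (i + (if i < k + 3 then 0 else q * k))],
   \matrix_(i, j) code k (nth x0 w) (i * k + j + 3)).
have -> : k ^ s * num_words2 D q k = #|[predX {: {ffun 'I_s -> 'I_k}}
    & [pred w : 'M[letter]_(q, k) | w \in @D q k]]|.
  by rewrite cardX card_ffun !card_ord.
apply: (@leq_card_inj _ _ _ _ f) => [w w'|w].
  rewrite !inE => /(T3P x0 _ (ltnW (ltnW (ltnW k5)))) Hw.
  move=> /(T3P x0 _ (ltnW (ltnW (ltnW k5)))) Hw' [/ffunP ef /matrixP em].
  rewrite size_tuple in Hw; rewrite size_tuple in Hw'.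
  suff E i : i < n -> nth x0 w i = nth x0 w' i.
    by apply/val_inj/(@eq_from_nth _ x0); rewrite !size_tuple.
  elim/ltn_ind: i => i IH lin.
  have [i1|i1] := ltnP i (k + 3).
    have li : i < s by rewrite /s; lia.
    by have := ef (Ordinal li); rewrite !ffunE /= i1 addn0.
  have [i2|i2] := ltnP i (q * k + k + 3); last first.
    have li : i - q * k < s by rewrite /s; lia.
    have := ef (Ordinal li); rewrite !ffunE /=.
    have -> : (i - q * k < k + 3) = false by lia.
    by rewrite subnK; last lia.
  pose t := i - k - 3.
  have tq : t %/ k < q by rewrite ltn_divLR // /t; lia.
  have tk : t %% k < k by rewrite ltn_mod.
  have := em (Ordinal tq) (Ordinal tk); rewrite /= !mxE /= -divn_eq => ec.
  have -> : i = t + 3 + k by rewrite /t; lia.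
  rewrite (source_code k5 Hw) ?(source_code k5 Hw') /t; try lia.
  rewrite ec; apply: IH; case: (code _ _ _) => /=; lia.
move=> wT; have : tval w \in T3 k := wT.
rewrite inE => /(T3P x0 _ (ltnW (ltnW (ltnW k5)))); rewrite size_tuple => Hw.
have [d1 d2 d3] := helical_code k5 Hw.
have lt_qk (i : 'I_q) (j : 'I_k) : i * k + j < q * k.
  apply: (@leq_trans (i.+1 * k)); last by rewrite leq_mul2r ltn_ord orbT.
  by rewrite mulSnr ltn_add2l.
apply/andP; split=> //; apply/in_D; split.
- move=> i j j' jj; rewrite /= !mxE jj (addnS (i * k)); apply: d1.
  by have := lt_qk i j'; rewrite jj /=; lia.
- move=> i i' j ii; rewrite /= !mxE ii mulSnr (addnAC (i * k) k); apply: d2.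
  by have := lt_qk i' j; rewrite ii mulSnr /=; lia.
- move=> i i' j j' ii jj; rewrite /= !mxE ii jj mulSnr.
  rewrite !(addnAC (i * k) k) !(addnS (i * k)).
  apply: d3.
  by have := lt_qk i' j'; rewrite ii jj mulSnr /=; lia.
Qed.

End Counting.

(** * A two-dimensional Fekete lemma *)

Section SubadditiveArrays.
Variables (R : realType) (F : nat -> nat -> R) (c : R).
Hypotheses (F_ge0 : forall n m, 0 <= F n m)
  (F_le : forall n m, F n m <= c * n%:R * m%:R)
  (F_rows : forall n1 n2 m, F (n1 + n2)%N m <= F n1 m + F n2 m)
  (F_columns : forall n m1 m2, F n (m1 + m2)%N <= F n m1 + F n m2).

Definition mean_inf : R :=
  inf (range (fun p : nat * nat => F p.1.+1 p.2.+1 / (p.1.+1%:R * p.2.+1%:R))).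

Let mean_ge0 (p : nat * nat) : 0 <= F p.1.+1 p.2.+1 / (p.1.+1%:R * p.2.+1%:R).
Proof. by rewrite divr_ge0 ?mulr_ge0. Qed.

Let has_inf_mean :
  has_inf (range (fun p : nat * nat => F p.1.+1 p.2.+1 / (p.1.+1%:R * p.2.+1%:R))).
Proof.
split; first by eexists; exists (0%N, 0%N).
by exists 0 => _ [p _ <-].
Qed.

Lemma mean_inf_ge0 : 0 <= mean_inf.
Proof.
by apply: lb_le_inf; [case: has_inf_mean | move=> _ [p _ <-]].
Qed.

Lemma mean_inf_le n m : mean_inf * n%:R * m%:R <= F n m.
Proof.
case: n => [|n]; first by rewrite mulr0 mul0r.
case: m => [|m]; first by rewrite mulr0.
rewrite -mulrA -ler_pdivlMr ?mulr_gt0 ?ltr0n //.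
by apply: ge_inf; [case: has_inf_mean | exists (n, m)].
Qed.

Let F_rowsM q a r m : F (q * a + r)%N m <= q%:R * F a m + F r m.
Proof.
elim: q => [|q IH]; first by rewrite mul0r add0r.
rewrite mulSn -addnA (le_trans (F_rows _ _ _)) // -natr1 mulrDl mul1r.
by rewrite [q%:R * _ + _]addrC -addrA lerD2l.
Qed.

Let F_columnsM n q b r : F n (q * b + r)%N <= q%:R * F n b + F n r.
Proof.
elim: q => [|q IH]; first by rewrite mul0r add0r.
rewrite mulSn -addnA (le_trans (F_columns _ _ _)) // -natr1 mulrDl mul1r.
by rewrite [q%:R * _ + _]addrC -addrA lerD2l.
Qed.

(** Blocks of size a x b with mean near the infimum tile the n x m rectangle up to two margins,
    whose cost is linear in n + m. *)
Lemma mean_inf_near e : 0 < e -> exists N : nat, forall n m,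
  (N <= n)%N -> (N <= m)%N -> F n m <= (mean_inf + e) * n%:R * m%:R.
Proof.
move=> e0; have e40 : 0 < e / 4 by rewrite divr_gt0.
have [_ [[a' b'] _ <-] /=] := inf_adherent e40 has_inf_mean.
rewrite -/mean_inf; set a := a'.+1; set b := b'.+1; set t := _ / _ => t_lt.
have a0 : 0 < a%:R :> R by rewrite ltr0n.
have b0 : 0 < b%:R :> R by rewrite ltr0n.
have t0 : 0 <= t by exact: (mean_ge0 (a', b')).
have FE : F a b = t * (a%:R * b%:R) by rewrite divfK // gt_eqF ?mulr_gt0.
have c0 : 0 <= c by have := le_trans (F_ge0 1 1) (F_le 1 1); rewrite !mulr1.
(* Beyond this threshold c (a + b) is at most e / 4 times n and times m, so each margin costs at
   most (e / 4) n m. *)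
exists (Num.truncn (c * (a%:R + b%:R) / (e / 4))).+1 => n m nN mN.
have bound (j : nat) : (Num.truncn (c * (a%:R + b%:R) / (e / 4)) < j)%N ->
    c * (a%:R + b%:R) <= e / 4 * j%:R.
  rewrite truncn_lt_nat; last by rewrite divr_ge0 ?mulr_ge0 ?addr_ge0 // ltW.
  by rewrite ltr_pdivrMr // [_ * (e / 4)]mulrC => /ltW.
move: {nN mN} (bound _ nN) (bound _ mN) => nN mN.
have nE := divn_eq n a; have mE := divn_eq m b.
have ra : (n %% a <= a)%N by rewrite ltnW // ltn_mod.
have rb : (m %% b <= b)%N by rewrite ltnW // ltn_mod.
set q := (n %/ a)%N in nE; set p := (m %/ b)%N in mE.
set r := (n %% a)%N in nE ra; set r' := (m %% b)%N in mE rb.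
have qa : q%:R * a%:R <= n%:R :> R by rewrite -natrM ler_nat nE leq_addr.
have pb : p%:R * b%:R <= m%:R :> R by rewrite -natrM ler_nat mE leq_addr.
have H1 : F n m <= q%:R * F a m + F r m by rewrite {1}nE.
have H2 : F a m <= p%:R * F a b + F a r' by rewrite {1}mE.
have H3 : F r m <= c * a%:R * m%:R.
  by rewrite (le_trans (F_le _ _)) // ler_wpM2r // ler_wpM2l // ler_nat.
have H4 : F a r' <= c * a%:R * b%:R.
  by rewrite (le_trans (F_le _ _)) // ler_wpM2l ?mulr_ge0 // ler_nat.
have H5 : q%:R * F a m <= q%:R * (p%:R * F a b + c * a%:R * b%:R).
  by rewrite ler_wpM2l // (le_trans H2) // lerD2l.
have H6 : t * (q%:R * a%:R) * (p%:R * b%:R) <= t * n%:R * m%:R.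
  by rewrite ler_pM ?mulr_ge0 // ler_wpM2l.
have H7 : c * b%:R * (q%:R * a%:R) <= c * b%:R * n%:R.
  by rewrite ler_wpM2l ?mulr_ge0.
have H8 : c * (a%:R + b%:R) * n%:R <= e / 4 * m%:R * n%:R by rewrite ler_wpM2r.
have H9 : c * (a%:R + b%:R) * m%:R <= e / 4 * n%:R * m%:R by rewrite ler_wpM2r.
have H10 : 0 <= c * a%:R * n%:R by rewrite !mulr_ge0.
have H11 : 0 <= c * b%:R * m%:R by rewrite !mulr_ge0.
have H12 : t * n%:R * m%:R <= (mean_inf + e / 4) * n%:R * m%:R.
  by rewrite !ler_wpM2r // ltW.
rewrite FE in H5.
have E : q%:R * (p%:R * (t * (a%:R * b%:R)) + c * a%:R * b%:R) =
  t * (q%:R * a%:R) * (p%:R * b%:R) + c * b%:R * (q%:R * a%:R) by ring.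
rewrite E in H5.
have H13 : 0 <= e / 4 * n%:R * m%:R by rewrite !mulr_ge0 // ltW.
by lra.
Qed.

End SubadditiveArrays.

(** * Growth rates *)

Section LimitSuperior.
Variables (R : realType) (u : nat -> R).

Lemma bounded_fun_ge0 (M : R) :
  (forall n, 0 <= u n <= M) -> bounded_fun (u : nat -> R^o).
Proof.
move=> uM; exists M; split; first exact: num_real.
move=> x Mx n _ /=; have /andP[u0 un] := uM n.
by rewrite ger0_norm // (le_trans un) // ltW.
Qed.

Lemma limn_sup_ge (l : R) : bounded_fun (u : nat -> R^o) ->
  (forall N, exists2 n, (N <= n)%N & l <= u n) -> l <= limn_sup u.
Proof.
move=> ub H; rewrite limn_supE //; apply: lb_le_inf; first by exists (sups u 0%N), 0%N.
move=> _ [N _ <-]; have [n Nn ln] := H N.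
apply: (le_trans ln); apply: ub_le_sup; last by exists n.
have [M Mub] := bounded_fun_has_ubound ub.
by exists M => _ [j _ <-]; apply: Mub; exists j.
Qed.

Lemma limn_sup_le (l : R) (N : nat) : bounded_fun (u : nat -> R^o) ->
  (forall n, (N <= n)%N -> u n <= l) -> limn_sup u <= l.
Proof.
move=> ub H; rewrite limn_supE //.
apply: (@le_trans _ _ (sups u N)).
  by apply: ge_inf; [exact: bounded_fun_has_lbound_sups | exists N].
apply: ge_sup; first by exists (u N), N => /=.
by move=> _ [j Nj <-]; exact: H.
Qed.

End LimitSuperior.

(** * The entropy of D and its comparison with the growth rates *)

Section Entropy.
Variable R : realType.

Definition log_num_words2 (n m : nat) : R := ln (num_words2 D n m)%:R.

Let num_words2_gt0' n m : (0 : R) < (num_words2 D n m)%:R.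
Proof. by rewrite ltr0n num_words2_gt0. Qed.

Lemma log_num_words2_ge0 n m : 0 <= log_num_words2 n m.
Proof. by rewrite /log_num_words2 ln_ge0 // ler1n num_words2_gt0. Qed.

Lemma log_num_words2_le n m :
  log_num_words2 n m <= ln (#|{: letter}|%:R : R) * n%:R * m%:R.
Proof.
have l0 : (0 < #|{: letter}|)%N by apply/card_gt0P; exists letV.
rewrite -mulrA -natrM mulr_natr -lnXn ?ltr0n // -natrX.
rewrite ler_ln ?posrE ?ltr0n ?expn_gt0 ?l0 ?num_words2_gt0 //.
by rewrite ler_nat -card_mx; apply: max_card.
Qed.

Lemma log_num_words2_rows n1 n2 m :
  log_num_words2 (n1 + n2) m <= log_num_words2 n1 m + log_num_words2 n2 m.
Proof.
rewrite /log_num_words2 -lnM ?posrE // -natrM.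
rewrite ler_ln ?posrE ?ltr0n ?muln_gt0 ?num_words2_gt0 //.
by rewrite ler_nat num_words2_rows.
Qed.

Lemma log_num_words2_columns n m1 m2 :
  log_num_words2 n (m1 + m2) <= log_num_words2 n m1 + log_num_words2 n m2.
Proof.
rewrite /log_num_words2 -lnM ?posrE // -natrM.
rewrite ler_ln ?posrE ?ltr0n ?muln_gt0 ?num_words2_gt0 //.
by rewrite ler_nat num_words2_columns.
Qed.

Definition entropy : R := mean_inf log_num_words2.

Lemma entropy_ge0 : 0 <= entropy.
Proof. exact/mean_inf_ge0/log_num_words2_ge0. Qed.

Lemma entropy_le n m : entropy * n%:R * m%:R <= log_num_words2 n m.
Proof. exact/mean_inf_le/log_num_words2_ge0. Qed.

Lemma entropy_near e : 0 < e -> exists N : nat, forall n m,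
  (N <= n)%N -> (N <= m)%N -> log_num_words2 n m <= (entropy + e) * n%:R * m%:R.
Proof.
exact: (mean_inf_near log_num_words2_ge0 log_num_words2_le
  log_num_words2_rows log_num_words2_columns).
Qed.

Lemma powR_exp (a x : R) : 0 < a -> a `^ x = expR (x * ln a).
Proof. by move=> a0; rewrite /powR gt_eqF. Qed.

Lemma cvg_root_num_words2 :
  root_num_words2 R D nm @[nm --> (\oo, \oo)] --> expR entropy.
Proof.
have -> : root_num_words2 R D =
    fun nm => expR (log_num_words2 nm.1 nm.2 / (nm.1%:R * nm.2%:R)).
  by apply/funext => nm; rewrite /root_num_words2 powR_exp // natrM mulrC.
apply: continuous_cvg; first exact: continuous_expR.
apply/cvgrPdist_le => e e0; have [N HN] := entropy_near e0.
exists ([set n | (N.+1 <= n)%N], [set n | (N.+1 <= n)%N]) => /=.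
  by split; exact: nbhs_infty_ge.
move=> [n m] /= [Nn Nm].
have nm0 : (0 : R) < n%:R * m%:R.
  by rewrite mulr_gt0 // ltr0n; [apply: leq_trans Nn | apply: leq_trans Nm].
rewrite ler_distlC; apply/andP; split.
  rewrite ler_pdivlMr // mulrA (le_trans _ (entropy_le n m)) //.
  by rewrite !ler_wpM2r // gerBl ltW.
by rewrite ler_pdivrMr // mulrA HN // ltnW.
Qed.

Lemma growth_rate_bounded k :
  bounded_fun (fun n => (num_words (T3 k) n)%:R `^ n%:R^-1 : R^o).
Proof.
(* The summand 1 covers the term n = 0, which equals 1. *)
apply: (@bounded_fun_ge0 _ _ (k%:R + 1)) => n; rewrite powR_ge0 /=.
case: n => [|n]; first by rewrite invr0 powRr0 lerDr.
apply: (@le_trans _ _ k%:R); last by rewrite lerDl.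
have -> : k%:R = (k%:R `^ n.+1%:R) `^ n.+1%:R^-1 :> R.
  by rewrite -powRrM divff ?pnatr_eq0 // powRr1.
apply: ge0_ler_powR; rewrite ?nnegrE ?powR_ge0 //.
rewrite powR_mulrn // -natrX ler_nat.
by rewrite -[X in (_ <= X ^ _)%N]card_ord -card_tuple; exact: max_card.
Qed.

Lemma growth_rate_T3_le e : 0 < e ->
  exists K : nat, forall k, (K <= k)%N -> growth_rate R (T3 k) <= expR (entropy + e).
Proof.
move=> e0; have e20 : 0 < e / 2 by rewrite divr_gt0.
have [N HN] := entropy_near e20.
exists (N + 5)%N => k Kk.
have k5 : (5 <= k)%N by lia.
have k0 : (0 : R) < k%:R by rewrite ltr0n; lia.
(* Since n - q k <= 2k + 5 for the q chosen below, [C] bounds the logarithm of the factor k^(n - q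
   k). *)
pose C : R := (k.*2 + 5)%:R * ln k%:R.
have C0 : 0 <= C by rewrite mulr_ge0 // ln_ge0 // ler1n; lia.
apply: (@limn_sup_le _ _ _ (N * k + k + 6 + Num.truncn (C / (e / 2)))%N).
  exact: growth_rate_bounded.
move=> n nN.
have n0 : (0 : R) < n%:R by rewrite ltr0n; lia.
have Cn : C <= e / 2 * n%:R.
  have : (Num.truncn (C / (e / 2)) < n)%N by lia.
  rewrite truncn_lt_nat; last by rewrite divr_ge0 // ltW.
  by rewrite ltr_pdivrMr // mulrC => /ltW.
set f := num_words _ _; have [f0|f0] := posnP f.
  rewrite f0 powR0 ?expR_ge0 // invr_neq0 // gt_eqF //.
rewrite powR_exp ?ltr0n // ler_expR mulrC ler_pdivrMr //.
pose q := ((n - (k + 5)) %/ k)%N.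
have qE := divn_eq (n - (k + 5)) k; rewrite -/q in qE.
have rk : ((n - (k + 5)) %% k < k)%N by rewrite ltn_mod; lia.
have Nq : (N <= q)%N by rewrite leq_divRL; lia.
have /(num_words_T3_le k5) : (q * k + k + 5 <= n)%N by lia.
rewrite -/f -(ler_nat R) natrM natrX => f_le.
have fR : (0 : R) < f%:R by rewrite ltr0n.
move: f_le; rewrite -ler_ln ?posrE ?mulr_gt0 ?exprn_gt0 // lnM ?posrE ?exprn_gt0 //.
rewrite lnXn // -/(log_num_words2 q k) => /le_trans; apply.
have -> : (entropy + e) * n%:R = e / 2 * n%:R + (entropy + e / 2) * n%:R by lra.
apply: lerD.
  apply: le_trans Cn; rewrite /C -[ln _ *+ _]mulr_natl.
  by rewrite ler_wpM2r ?ln_ge0 ?ler1n ?ler_nat //; lia.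
apply: (le_trans (HN _ _ Nq _)); first by lia.
rewrite -mulrA ler_wpM2l //; first by rewrite addr_ge0 ?entropy_ge0 ?ltW.
by rewrite -natrM ler_nat; lia.
Qed.

Lemma growth_rate_T3_ge e : 0 < e ->
  exists K : nat, forall k, (K <= k)%N -> expR (entropy - e) <= growth_rate R (T3 k).
Proof.
move=> e0; have s0 := entropy_ge0; set s := entropy in s0 *.
exists (Num.truncn (10 * s / e) + 10)%N => k Kk.
have [m kE] : exists m, k = (m.+1 + 9)%N by exists (k - 10)%N; lia.
have k0 : (0 : R) < k%:R by rewrite ltr0n; lia.
have sk : 10 * s <= e * k%:R.
  have : (Num.truncn (10 * s / e) < k)%N by lia.
  rewrite truncn_lt_nat; last by rewrite divr_ge0 ?mulr_ge0 // ltW.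
  by rewrite ltr_pdivrMr // (mulrC _ e) => /ltW.
apply: limn_sup_ge; first exact: growth_rate_bounded.
(* Because q >= k, the k initial letters cost at most s q, as much as one more column of height q.
   Together with the 9 columns of the strip this gives the 10 in the threshold for k. *)
move=> N; pose q := (N + k)%N; exists (q.+1 * k + k)%N.
  by rewrite /q; nia.
have := num_words_T3_ge q m; rewrite -kE -(ler_nat R).
set n := (_ * _ + _)%N; set f := num_words _ _ => f_ge.
have fN : (0 < f)%N.
  by rewrite -(ltr0n R); apply: lt_le_trans f_ge; rewrite ltr0n num_words2_gt0.
have f0 : (0 : R) < f%:R by rewrite ltr0n.
have n0 : (0 : R) < n%:R by rewrite ltr0n /n; lia.
rewrite powR_exp // ler_expR mulrC ler_pdivlMr //.
move: f_ge; rewrite -ler_ln ?posrE ?ltr0n ?num_words2_gt0 //.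
apply: le_trans; apply: le_trans (entropy_le _ _); rewrite -/s.
have -> : m.+1%:R = k%:R - 9 :> R by rewrite kE natrD addrK.
have -> : n%:R = (q%:R + 2) * k%:R :> R by rewrite /n -mulSnr natrM -!natr1; lra.
rewrite -natr1.
have kq : k%:R <= q%:R :> R by rewrite ler_nat leq_addl.
have q0 : 0 <= q%:R :> R by [].
have h1 : 10 * s * q%:R <= e * k%:R * q%:R by rewrite ler_wpM2r.
have h2 : s * k%:R <= s * q%:R by rewrite ler_wpM2l.
have h3 : 0 <= e * k%:R by rewrite mulr_ge0 // ltW.
lra.
Qed.

End Entropy.

Theorem theorem2 (R : realType) :
  cvg (root_num_words2 R D nm @[nm --> (\oo, \oo)]) /\
  growth_rate R (T3 k) @[k --> \oo] --> growth_rate2 R D.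
Proof.
have root_cvg := @cvg_root_num_words2 R.
split; first by apply/cvg_ex; exists (expR (entropy R)).
have -> : growth_rate2 R D = expR (entropy R) by exact/cvg_lim.
apply/cvgrPdist_le => e e0.
(* Continuity of the exponential turns an error d / 2 in the exponent into an error of at most e. *)
have [d /= d0 Hd] : nbhs (entropy R) [set x | `|expR (entropy R) - expR x| <= e].
  by move/cvgrPdist_le: (@continuous_expR R (entropy R)); apply.
have d20 : 0 < d / 2 by rewrite divr_gt0.
have [K1 HK1] := growth_rate_T3_le d20.
have [K2 HK2] := growth_rate_T3_ge d20.
exists (K1 + K2)%N => // k /= Kk.
have /HK1 up : (K1 <= k)%N by lia.
have /HK2 lo : (K2 <= k)%N by lia.
have := Hd (entropy R + d / 2); have := Hd (entropy R - d / 2).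
rewrite /ball /= !ler_distlC => hm hp.
have [|hm1 _] := andP (hm _); first by rewrite ltr_norml; lra.
have [|_ hp2] := andP (hp _); first by rewrite ltr_norml; lra.
apply/andP; split; first exact: le_trans lo.
exact: le_trans up _.
Qed.
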